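(* Let $G$ be a compactly generated locally compact metabelian group and $(N_n)_{n\ge0}$ an ascending sequence of closed normal subgroups of $G$. Let $N=\overline{\bigcup_n N_n}$. Then there exists $n_0$ such that $N_n$ is cocompact in $N$ for all $n\ge n_0$.
   Context: A locally compact group is metabelian if its derived subgroup $[G,G]$ is abelian. Compactly generated means generated as an abstract group by a compact subset. *)

(* Defs.v *)
From HB Require Import structures.
From mathcomp Require Import all_boot all_order.
From mathcomp Require Import all_classical.
From mathcomp Require Import topology.

Set Implicit Arguments.
Unset Strict Implicit.
Unset Printing Implicit Defensive.

Local Open Scope classical_set_scope.
Local Open Scope group_scope.

HB.mixin Record Group_isTopological G of Group G & Topological G := {
  mulg_continuous : continuous (fun p : G * G => p.1 * p.2);
  invg_continuous : continuous (fun x : G => x^-1)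
}.

#[short(type="topGroupType")]
HB.structure Definition TopGroup :=
  {G of Group_isTopological G & Group G & Topological G}.

Section TopGroupDefs.
Variable G : topGroupType.

Definition is_subgroup (H : set G) : Prop :=
  [/\ H 1, (forall x y, H x -> H y -> H (x * y)) & (forall x, H x -> H x^-1)].

Definition is_normal_subgroup (H : set G) : Prop :=
  is_subgroup H /\ (forall x g, H x -> H (x ^ g)).

Definition is_closed_normal_subgroup (H : set G) : Prop :=
  is_normal_subgroup H /\ closed H.

Definition generated_subgroup (A : set G) : set G :=
  [set x | forall H : set G, is_subgroup H -> A `<=` H -> H x].

Definition derived_subgroup : set G :=
  generated_subgroup [set [~ x, y] | x in [set: G] & y in [set: G]].

Definition metabelian : Prop :=
  forall x y, derived_subgroup x -> derived_subgroup y -> x * y = y * x.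

Definition locally_compact_group : Prop :=
  hausdorff_space G /\ forall x : G, exists K : set G, nbhs x K /\ compact K.

Definition compactly_generated : Prop :=
  exists K : set G, compact K /\ generated_subgroup K = [set: G].

Definition cocompact_in (H N : set G) : Prop :=
  exists K : set G, compact K /\ N = [set k * h | k in K & h in H].

End TopGroupDefs.

(* Main.v *)
Require Import Defs.
From HB Require Import structures.
From mathcomp Require Import all_boot all_order.
From mathcomp Require Import all_classical.
From mathcomp Require Import topology.

Set Implicit Arguments.
Unset Strict Implicit.
Unset Printing Implicit Defensive.

(**
  Call a closed normal subgroup [N] of [G] compactly generated over [G] if it is
  generated by the conjugates of a compact set.  If moreover the union of the
  [N_n] is dense in [N], then finitely many elements of that union already
  generate [N] modulo a compact neighbourhood [U] of [1] in [N]: choose a finite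
  set [F] with [U U], the relevant conjugates of [U] and the compact generators
  all contained in [U F]; as soon as [F <= N_n], the set [U N_n] is a normal
  subgroup, hence is all of [N].  It thus suffices that every closed normal
  subgroup of [G] be compactly generated over [G].

  There is a finitely generated subgroup <gs> with [G = S <gs>], [S] compact, and
  [A = closure [G, G]] is a compactly generated module over <gs>, which acts on
  it through an abelian group.  Closed submodules of such modules are compactly
  generated by Hilbert's basis argument, inducting on the number of acting
  generators: the modules of leading coefficients are open, so the increasing
  sequence they form stabilizes.  The induction starts with closed subgroups of
  compactly generated abelian groups.  This handles [N :&: A].  As [N] is
  central modulo [N :&: A], the closure of [N A] is abelian modulo [N :&: A],
  and the same argument applied to it handles [N / (N :&: A)].
*)

Local Open Scope classical_set_scope.
Local Open Scope group_scope.

(** * Continuity, compactness and neighbourhoods in topological groups *)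

Section TopGroupBasics.
Variable G : topGroupType.
Implicit Types (x y z g : G) (A B C D H K M N U V W X : set G).
Implicit Types (E F gs : seq G).

Definition mulset A B : set G := [set a * b | a in A & b in B].

Lemma mulsetS A A' B B' : A `<=` A' -> B `<=` B' ->
  mulset A B `<=` mulset A' B'.
Proof.
move=> sA sB _ [a Aa [b Bb <-]].
by exists a; [exact: sA|exists b; [exact: sB|]].
Qed.

Lemma continuous_mulg (T : topologicalType) (f h : T -> G) :
  continuous f -> continuous h -> continuous (fun t => f t * h t).
Proof.
move=> cf ch t.
apply: (@continuous_comp _ _ _ (fun t => (f t, h t)) (fun p : G * G => p.1 * p.2)).
  by apply: cvg_pair; [exact: cf|exact: ch].
exact: mulg_continuous.
Qed.

Lemma continuous_invg (T : topologicalType) (f : T -> G) :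
  continuous f -> continuous (fun t => (f t)^-1).
Proof.
by move=> cf t; apply: continuous_comp; [exact: cf|exact: invg_continuous].
Qed.

Lemma continuous_conjg (T : topologicalType) (f h : T -> G) :
  continuous f -> continuous h -> continuous (fun t => f t ^ h t).
Proof.
move=> cf ch; apply: continuous_mulg; first exact: continuous_invg.
exact: continuous_mulg.
Qed.

Lemma continuous_idfun (T : topologicalType) : continuous (fun t : T => t).
Proof. by move=> t; exact: cvg_id. Qed.

Lemma compact_map (T U : topologicalType) (f : T -> U) (K : set T) :
  continuous f -> compact K -> compact (f @` K).
Proof.
move=> cf; apply: continuous_compact.
exact: continuous_subspaceT.
Qed.

Lemma compact_image2 (f : G -> G -> G) K X :
  continuous (fun p : G * G => f p.1 p.2) -> compact K -> compact X ->
  compact [set f x y | x in K & y in X].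
Proof.
move=> cf cK cX; have := compact_map cf (compact_setX cK cX).
suff -> : [set f x y | x in K & y in X] =
  (fun p : G * G => f p.1 p.2) @` (K `*` X) by [].
apply/seteqP; split=> [_ [x Kx [y Xy <-]]|_ [[x y] [/= Kx Xy] <-]].
  by exists (x, y).
by exists x => //; exists y.
Qed.

Lemma continuous_pair1 : continuous (fun p : G * G => p.1).
Proof. by move=> p; exact: cvg_fst. Qed.

Lemma continuous_pair2 : continuous (fun p : G * G => p.2).
Proof. by move=> p; exact: cvg_snd. Qed.

Lemma compact_mulset K X : compact K -> compact X -> compact (mulset K X).
Proof. by apply: compact_image2; apply: mulg_continuous. Qed.

Lemma compact_inv K : compact K -> compact [set x^-1 | x in K].
Proof. apply: compact_map; exact: invg_continuous. Qed.

Lemma compact_conj K g : compact K -> compact [set x ^ g | x in K].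
Proof.
apply: compact_map; apply: continuous_conjg; first exact: continuous_idfun.
exact: cst_continuous.
Qed.

Lemma nbhs_preim (f : G -> G) x V : continuous f -> nbhs (f x) V ->
  nbhs x [set y | V (f y)].
Proof. by move=> cf; exact: cf. Qed.

Lemma nbhs1_conj V g : nbhs (1 : G) V -> nbhs (1 : G) [set y | V (y ^ g)].
Proof.
move=> V1; apply: (nbhs_preim (f := fun y => y ^ g)); last by rewrite conj1g.
by apply: continuous_conjg; [exact: continuous_idfun|exact: cst_continuous].
Qed.

Lemma nbhs1_inv V : nbhs (1 : G) V -> nbhs (1 : G) [set y | V y^-1].
Proof.
by move=> V1; apply: (nbhs_preim (@invg_continuous G)); rewrite invg1.
Qed.

Lemma nbhs_ldiv V x : nbhs (1 : G) V -> nbhs x [set y | V (x * y^-1)].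
Proof.
move=> V1; apply: (nbhs_preim (f := fun y => x * y^-1)); last by rewrite mulgV.
apply: continuous_mulg; first exact: cst_continuous.
exact: invg_continuous.
Qed.

Lemma nbhs_rdiv V x : nbhs (1 : G) V -> nbhs x [set y | V (y * x^-1)].
Proof.
move=> V1; apply: (nbhs_preim (f := fun y => y * x^-1)); last by rewrite mulgV.
by apply: continuous_mulg; [exact: continuous_idfun|exact: cst_continuous].
Qed.

Lemma nbhs1_split V : nbhs (1 : G) V ->
  exists2 W, nbhs (1 : G) W & forall x y, W x -> W y -> V (x * y).
Proof.
move=> V1; have : nbhs ((1, 1) : G * G) [set p | V (p.1 * p.2)].
  by apply: (@mulg_continuous G (1, 1)); rewrite /= mulg1.
case=> [[W1 W2] [/= n1 n2] sW]; exists (W1 `&` W2); first exact: filterI.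
by move=> x y [Wx _] [_ Wy]; exact: (sW (x, y)).
Qed.

Lemma closure_ldiv D V x : closure D x -> nbhs (1 : G) V ->
  exists2 d, D d & V (x * d^-1).
Proof. by move=> clx V1; have [d [Dd Vd]] := clx _ (nbhs_ldiv x V1); exists d. Qed.

Lemma closure_map (f : G -> G) D N : continuous f -> closed N ->
  (forall x, D x -> N (f x)) -> forall x, closure D x -> N (f x).
Proof.
move=> cf clN DN x clx; apply: clN => V /(nbhs_preim cf) nV.
by have [d [Dd Vd]] := clx _ nV; exists (f d); split=> //; exact: DN.
Qed.

Lemma closure_min D N : closed N -> D `<=` N -> closure D `<=` N.
Proof. by move=> clN /closureS /subset_trans; exact. Qed.

(** Each point of [C] has a neighbourhood inside a single translate [V d] with [d] in [D];
    compactness leaves finitely many. *)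
Lemma compact_translates C D V : compact C -> C `<=` closure D ->
  nbhs (1 : G) V -> exists F, (forall f, f \in F -> D f) /\
    forall c, C c -> exists2 f, f \in F & V (c * f^-1).
Proof.
move=> cC CD V1.
(* Finite subsets of [D], directed by inclusion, give the filter to which near-covering compactness
   is applied. *)
pose good : set (seq G) := [set s | forall f, f \in s -> D f].
pose base (s0 : seq G) : set (seq G) := [set s | {subset s0 <= s} /\ good s].
have FF : Filter (filter_from good base).
  apply: filter_from_filter; first by exists [::].
  move=> s t gs gt; exists (s ++ t).
    by move=> f; rewrite mem_cat => /orP[/gs|/gt].
  by move=> u [su gu]; split; split=> // f fs; apply: su; rewrite mem_cat fs ?orbT.
have := (compact_near_coveringP C).1 cC _ _
  (fun s c => exists2 f, f \in s & V (c * f^-1)) FF.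
case=> [c Cc|s gs bs].
  have [W W1 WV] := nbhs1_split V1.
  have [d Dd Wd] := closure_ldiv (CD c Cc) W1.
  exists ([set y | W (y * c^-1)], base [:: d]).
    split=> /=; first exact: nbhs_rdiv.
    by exists [:: d] => // f; rewrite inE => /eqP ->.
  move=> [y s] /= [Wy [ds _]]; exists d; first by apply: ds; rewrite inE.
  by rewrite -[y](mulgVK c) -mulgA; exact: WV.
exists s; split=> // c; apply: bs; split=> //.
Qed.

(** * Subgroups, their closures and stability under conjugation *)

Section Subgroups.
Variables (H : set G) (sgH : is_subgroup H).
Lemma sg1 : H 1. Proof. by case: sgH. Qed.
Lemma sgM x y : H x -> H y -> H (x * y).
Proof. by case: sgH => _ + _; exact. Qed.
Lemma sgV x : H x -> H x^-1. Proof. by case: sgH => _ _; exact. Qed.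
Lemma sgX x n : H x -> H (x ^+ n).
Proof.
by move=> Hx; elim: n => [|n IH]; [exact: sg1|rewrite expgS; exact: sgM].
Qed.
Lemma sgMr x y : H x -> H (y * x) -> H y.
Proof. by move=> Hx Hyx; rewrite -[y](mulgK x); apply: sgM => //; exact: sgV. Qed.
Lemma sgMl x y : H x -> H (x * y) -> H y.
Proof. by move=> Hx Hxy; rewrite -[y](mulKg x); apply: sgM => //; exact: sgV. Qed.
End Subgroups.

Lemma normal_of_commutators A x g : is_subgroup A -> (forall x y, A [~ x, y]) ->
  A x -> A (x ^ g).
Proof.
by move=> sA cA Ax; rewrite -[x ^ g](mulKg x^-1) invgK -commgEl; exact: sgM.
Qed.

Lemma subgroup_setI A B : is_subgroup A -> is_subgroup B -> is_subgroup (A `&` B).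
Proof.
move=> sA sB; split; first by split; exact: sg1.
  by move=> x y [? ?] [? ?]; split; exact: sgM.
by move=> x [? ?]; split; exact: sgV.
Qed.

Lemma subgroup_setT : is_subgroup [set: G].
Proof. by split. Qed.

Lemma subgroup_set1 : is_subgroup [set (1 : G)].
Proof.
by split=> [//|x y -> ->|x ->] /=; rewrite ?mulg1 ?invg1.
Qed.

Lemma subgroup_closure A : is_subgroup A -> is_subgroup (closure A).
Proof.
move=> sA; split; first by apply: subset_closure; exact: sg1.
  move=> x y Ax Ay.
  apply: (closure_map (f := fun x => x * y) (D := A)) Ax.
  - by apply: continuous_mulg; [exact: continuous_idfun|exact: cst_continuous].
  - exact: closed_closure.
  move=> {}x Ax; apply: (closure_map (f := fun y => x * y) (D := A)) Ay.
  - by apply: continuous_mulg; [exact: cst_continuous|exact: continuous_idfun].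
  - exact: closed_closure.
  by move=> {}y Ay; apply: subset_closure; exact: sgM.
move=> x; apply: (closure_map (f := fun y => y^-1) (D := A)).
- exact: invg_continuous.
- exact: closed_closure.
by move=> y Ay; apply: subset_closure; exact: sgV.
Qed.

Lemma closure_stable A g : (forall x, A x -> A (x ^ g)) ->
  forall x, closure A x -> closure A (x ^ g).
Proof.
move=> sA x; apply: (closure_map (f := fun y => y ^ g) (D := A)).
- by apply: continuous_conjg; [exact: continuous_idfun|exact: cst_continuous].
- exact: closed_closure.
by move=> y Ay; apply: subset_closure; exact: sA.
Qed.

(** The relative form of the closedness of open subgroups: a limit point [x] of [M] has [x * m^-1]
    in [V :&: B] for some [m] in [M]. *)
Lemma subgroup_relopen_closed B M V : closed B -> is_subgroup M -> is_subgroup B ->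
  M `<=` B -> nbhs (1 : G) V -> V `&` B `<=` M -> closed M.
Proof.
move=> clB sM sB MB V1 VM x clx.
have Bx : B x by apply: clB; exact: closureS clx.
have [m Mm Vm] := closure_ldiv clx V1.
apply: (sgMr sM (sgV sM Mm)); apply: VM; split=> //.
by apply: sgM => //; apply: sgV => //; exact: MB.
Qed.

(** Inverses are listed since [gs] need not be symmetric: this is stability under the group
    generated by [gs]. For [gs = [::]] it is void, and [stable_gen [::] X] is the subgroup generated
    by [X]. *)
Definition conj_stable gs M :=
  forall g x, g \in gs -> M x -> M (x ^ g) /\ M (x ^ g^-1).

Definition stable_gen gs X : set G :=
  [set x | forall M, is_subgroup M -> conj_stable gs M -> X `<=` M -> M x].

Lemma subgroup_stable_gen gs X : is_subgroup (stable_gen gs X).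
Proof.
split; first by move=> M sM _ _; exact: sg1.
  by move=> x y gx gy M sM tM XM; apply: sgM => //; [exact: gx|exact: gy].
by move=> x gx M sM tM XM; apply: sgV => //; exact: gx.
Qed.

Lemma conj_stable_gen gs X : conj_stable gs (stable_gen gs X).
Proof.
by move=> g x ggs gx; split=> M sM tM XM; have [] := tM _ _ ggs (gx M sM tM XM).
Qed.

Lemma sub_stable_gen gs X : X `<=` stable_gen gs X.
Proof. by move=> x Xx M _ _; exact. Qed.

Lemma stable_gen_min gs X M : is_subgroup M -> conj_stable gs M -> X `<=` M ->
  stable_gen gs X `<=` M.
Proof. by move=> sM tM XM x; exact. Qed.

Lemma stable_genS gs X Y : X `<=` stable_gen gs Y ->
  stable_gen gs X `<=` stable_gen gs Y.
Proof.
move=> XY; apply: stable_gen_min => //; first exact: subgroup_stable_gen.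
exact: conj_stable_gen.
Qed.

Lemma conj_stable_nil M : conj_stable [::] M. Proof. by []. Qed.

Lemma conj_stableX g gs M n x : conj_stable (g :: gs) M -> M x ->
  M (x ^ (g ^+ n)).
Proof.
move=> tM Mx; elim: n => [|n IH]; first by rewrite conjg1.
by rewrite expgSr conjgM; apply: (tM g _ _ _).1 => //; exact: mem_head.
Qed.

(* [N / H] is generated by the conjugates of a compact set under the group
   generated by [gs]; carrying [H] along avoids quotient groups. *)
Definition comp_gen gs H N :=
  exists W, [/\ compact W, W `<=` N & N `<=` stable_gen gs (W `|` H)].

End TopGroupBasics.

(** * Closed subgroups of compactly generated abelian quotients *)

Section CompactGeneration.
Variable G : topGroupType.
Implicit Types (x y z g : G) (A B C D H K M N U V W X : set G).
Implicit Types (E F gs : seq G).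

Lemma compact_bigcup_seq (T : choiceType) (s : seq T) (f : T -> set G) :
  (forall i, i \in s -> compact (f i)) -> compact (\bigcup_(i in [set` s]) f i).
Proof.
move=> cf; rewrite bigcup_seq big_seq.
by elim/big_ind: _ => [|X Y|i /cf//]; [exact: compact0|exact: compactU].
Qed.

Lemma compact_seq (s : seq G) : compact [set` s].
Proof. by apply: finite_compact; exact: finite_seq. Qed.

Definition abelian_mod A H := forall x y, A x -> A y -> H [~ x, y].

Lemma abelian_mod_sub A A' H H' : A' `<=` A -> H `<=` H' ->
  abelian_mod A H -> abelian_mod A' H'.
Proof. by move=> sA sH aAH x y /sA Ax /sA Ay; apply: sH; exact: aAH. Qed.

Lemma abelian_mod_conj A H M x y : abelian_mod A H -> is_subgroup M ->
  H `<=` M -> M `<=` A -> M x -> A y -> M (x ^ y).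
Proof.
move=> aAH sM HM MA Mx Ay; rewrite -[x ^ y](mulKg x^-1) invgK -commgEl.
by apply: sgM => //; apply: HM; apply: aAH => //; exact: MA.
Qed.

(** [F] is chosen so that the compact set [C] lies in [U F]. Once [M] contains [F], the product
    [C M] lies in [U M]; as [N] normalises [M], this makes [U M] a [gs]-stable subgroup. *)
Lemma dense_generators gs N D W H V :
  closed N -> is_subgroup N -> conj_stable gs N ->
  compact V -> nbhs (1 : G) V -> (forall x, V x -> V x^-1) ->
  compact W -> W `<=` N -> N `<=` stable_gen gs (W `|` H) ->
  D `<=` N -> N `<=` closure D ->
  exists F, (forall f, f \in F -> D f) /\ forall M, is_subgroup M ->
    conj_stable gs M -> M `<=` N -> (forall m n, M m -> N n -> M (m ^ n)) ->
    (forall f, f \in F -> M f) -> H `<=` M -> N `<=` mulset (V `&` N) M.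
Proof.
move=> clN sN tN cV V1 Vsym cW WN Ngen DN Ncl.
pose U := V `&` N.
have cU : compact U by exact: compact_closedI.
pose Cg g := [set x ^ g | x in U] `|` [set x ^ g^-1 | x in U].
pose C := mulset U U `|` (W `|` \bigcup_(g in [set` gs]) Cg g).
have cC : compact C.
  apply: compactU; first exact: compact_mulset.
  apply: compactU => //; apply: compact_bigcup_seq => g _.
  by apply: compactU; exact: compact_conj.
have CN : C `<=` N.
  move=> _ [[x [_ Nx] [y [_ Ny] <-]]|[/WN//|[g /= ggs [] [x [_ Nx] <-]]]].
  - exact: sgM.
  - exact: (tN _ _ ggs Nx).1.
  - exact: (tN _ _ ggs Nx).2.
have [F [FD FC]] := compact_translates cC (subset_trans CN Ncl) V1.
exists F; split=> // M sM tM MN nM FM HM.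
have CM c m : C c -> M m -> mulset U M (c * m).
  move=> Cc Mm; have [f fF Vf] := FC _ Cc.
  exists (c * f^-1).
    split=> //; apply: sgM => //; first exact: CN.
    by apply: sgV => //; exact/DN/FD.
  exists (f * m); first by apply: sgM => //; exact: FM.
  by rewrite mulgA mulgVK.
have U1 : U 1 by split; [exact: nbhs_singleton|exact: sg1].
apply: subset_trans Ngen _; apply: stable_gen_min.
- split.
  + by exists 1 => //; exists 1; [exact: sg1|rewrite mulg1].
  + move=> _ _ [u Uu [m Mm <-]] [v Uv [n Mn <-]].
    have -> : u * m * (v * n) = u * v * (m ^ v * n).
      by rewrite conjgE !mulgA mulgK.
    apply: CM; first by left; exists u => //; exists v.
    by apply: sgM => //; apply: nM => //; case: Uv.
  + move=> _ [u [Vu Nu] [m Mm <-]]; exists u^-1.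
      by split; [exact: Vsym|exact: sgV].
    exists (m^-1 ^ u^-1); first by apply: nM; exact: sgV.
    by rewrite conjgE invgK invgM !mulgA mulVg mul1g.
- move=> g _ ggs [u Uu [m Mm <-]]; rewrite !conjMg.
  have [Mg Mg'] := tM _ _ ggs Mm.
  by split; apply: CM => //; right; right; exists g => //; [left|right]; exists u.
- move=> x [Wx|Hx]; last by exists 1 => //; exists x; [exact: HM|rewrite mul1g].
  by rewrite -[x]mulg1; apply: CM; [right; left|exact: sg1].
Qed.

Lemma uniform_bound (T : eqType) (s : seq T) (Q : T -> nat -> Prop) :
  (forall i, i \in s -> exists n, Q i n) ->
  exists k, forall i, i \in s -> exists2 n, (n <= k)%N & Q i n.
Proof.
elim: s => [|i s IH] Qs; first by exists 0%N.
have [|N HN] := IH; first by move=> j js; apply: Qs; rewrite inE js orbT.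
have [n Qn] := Qs i (mem_head _ _).
exists (maxn n N) => j; rewrite inE => /predU1P[->|/HN[m mN Qm]].
  by exists n => //; exact: leq_maxl.
by exists m => //; rewrite leq_max mN orbT.
Qed.

(* Weil's lemma on monothetic groups, in [A / B]: if the powers of [z] return
   to compact sets infinitely often, then they return to every neighbourhood of
   [1], and compactness of [V] bounds the gaps between returns to [V]. *)
Lemma powers_precompact_or_proper A B V z :
  closed A -> is_subgroup A -> is_subgroup B -> B `<=` A -> abelian_mod A B ->
  compact V -> nbhs (1 : G) V -> A z ->
  (exists K, [/\ compact K, K `<=` A & forall n, mulset K B (z ^+ n)]) \/
  (forall K, compact K -> K `<=` A ->
    exists k, forall n, mulset K B (z ^+ n) -> (n < k)%N).
Proof.
move=> clA sA sB BA aAB cV V1 Az.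
have AX n : A (z ^+ n) by exact: sgX.
have nB b a : B b -> A a -> B (b ^ a) by exact: (abelian_mod_conj aAB sB).
have [?|/existsNP[K /not_implyP[cK /not_implyP[KA]]]] := pselect (forall K,
  compact K -> K `<=` A -> exists k, forall n, mulset K B (z ^+ n) -> (n < k)%N).
  by right.
(* The negated alternative supplies one compact [K] such that [K B] contains [z ^+ n] for
   arbitrarily large [n]. *)
move=> /forallNP Kinf; left.
have {}Kinf (N : nat) : exists2 n, (N <= n)%N & mulset K B (z ^+ n).
  have /existsNP[n /not_implyP[Kn /negP]] := Kinf N.
  by rewrite -leqNgt => Nn; exists n.
(* Pigeonhole: one of finitely many translates covering [K] receives, modulo [B], powers [z ^+ n1]
   and [z ^+ n2] with [n2] far beyond [n1]; then [z ^+ (n2 - n1)] is close to 1 modulo [B]. *)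
have recur W (N : nat) : nbhs (1 : G) W ->
    exists2 n, (N < n)%N & mulset (W `&` A) B (z ^+ n).
  move=> W1; have [X X1 XW] := nbhs1_split W1.
  have X1' : nbhs (1 : G) (X `&` [set y | X y^-1]).
    by apply: filterI => //; exact: nbhs1_inv.
  have [F [FK FX]] := compact_translates cK (@subset_closure _ K) X1'.
  pose Q f n := exists2 c, [/\ K c, X (c * f^-1) & X (c * f^-1)^-1] &
    exists2 b, B b & z ^+ n = c * b.
  have [f fF Qf] : exists2 f, f \in F & forall m, exists2 n, (m <= n)%N & Q f n.
    apply: contrapT => noF.
    have /uniform_bound[N0 HN0] f :
        f \in F -> exists m, forall n, (m <= n)%N -> ~ Q f n.
      move=> fF; apply: contrapT => /forallNP nof; apply: noF; exists f => // m.
      have /existsNP[n /not_implyP[mn /contrapT Qn]] := nof m.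
      by exists n.
    have [n N0n [c Kc [b Bb Ecb]]] := Kinf N0.
    have [f fF [Xf Xf']] := FX _ Kc.
    have [m mN0 /(_ n (leq_trans mN0 N0n))] := HN0 _ fF.
    by apply; exists c => //; exists b.
  have [n1 _ [c1 [Kc1 X11 X12] [b1 Bb1 E1]]] := Qf 0%N.
  have [n2 n12 [c2 [Kc2 X21 X22] [b2 Bb2 E2]]] := Qf (n1 + N.+1)%N.
  exists (n2 - n1)%N; first by rewrite ltn_subRL -addnS.
  have Af : A f by exact/KA/FK.
  have Aw c : K c -> A (c * f^-1).
    by move=> /KA Ac; apply: sgM => //; exact: sgV.
  rewrite expgnFr; last exact: leq_trans (leq_addr _ _) n12.
  exists (c2 * f^-1 * (c1 * f^-1)^-1).
    by split; [exact: XW|apply: sgM => //; [exact: Aw|apply: sgV; [|exact: Aw]]].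
  exists ((b2 * b1^-1) ^ c1^-1).
    apply: nB; first by apply: sgM => //; exact: sgV.
    by apply: sgV => //; exact: KA.
  by rewrite E1 E2 conjgE !invgM !invgK !mulgA !mulgVK.
(* Each [f] in the finite set [F] below has the form [z ^+ j * b], so a return time [m > j] gives a
   positive shift [m - j] moving [f] into [W B]. *)
pose P := [set z ^+ p.1 * p.2 | p in [set p : nat * G | B p.2]].
have PA : closure P `<=` A.
  apply: closure_min => // _ [[m b] /= Bb <-].
  by apply: sgM => //; exact: BA.
have cT : compact (V `&` closure P).
  by apply: compact_closedI => //; exact: closed_closure.
have [W W1 WV] := nbhs1_split V1.
have [F [FP FT]] := compact_translates cT (@subIsetr _ _ _) W1.
have /uniform_bound[N HN] f : f \in F ->
    exists n, (0 < n)%N /\ mulset (W `&` A) B (z ^+ n * f).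
  move=> /FP[[j b] /= Bb <-]; have [m jm [w [Ww Aw] [b' Bb' E]]] := recur W j W1.
  exists (m - j)%N; split; first by rewrite subn_gt0.
  exists w => //; exists (b' * b); first exact: sgM.
  by rewrite !mulgA -expgnDr subnK ?E // ltnW.
(* Gaps between returns to [V B] are at most [N]: a return [z ^+ m = v * b] puts [v] near some [f],
   and the shift found for [f] yields another return within the next [N] exponents. *)
have hit m : exists2 i, (i <= N)%N & mulset (V `&` A) B (z ^+ (m + i)).
  elim: m => [|m [[|i] iN]].
  - exists 0%N => //; exists 1; first by split; [exact: nbhs_singleton|exact: sg1].
    by exists 1; [exact: sg1|rewrite mulg1].
  - rewrite addn0 => -[v [Vv Av] [b Bb E]].
    have Tv : (V `&` closure P) v.
      split=> //; apply: subset_closure; exists (m, b^-1); first exact: sgV.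
      by rewrite /= -E mulgK.
    have [f fF Wf] := FT _ Tv.
    have [[|n] nN [// _ [w [Ww Aw] [b' Bb' E']]]] := HN _ fF.
    exists n; first exact: leq_trans nN.
    have Af : A f.
      by apply: PA; apply: subset_closure; exact: FP.
    have Au : A (v * f^-1) by apply: sgM => //; exact: sgV.
    exists (v * f^-1 * w).
      by split; [exact: WV|apply: sgM].
    (* The commutator, which lies in [B], compensates for exchanging [z ^+ n.+1] with [v * f^-1]. *)
    exists (b' * [~ z ^+ n.+1, v * f^-1] ^ f * b).
      by apply: sgM => //; apply: sgM => //; apply: nB => //; exact: aAB.
    rewrite addSnnS addnC expgnDr -E.
    set a := z ^+ n.+1 in E' *; set u := v * f^-1.
    have -> : u * w * (b' * [~ a, u] ^ f * b) = u * (w * b') * [~ a, u] ^ f * b.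
      by rewrite !mulgA.
    have -> : v = u * f by rewrite mulgVK.
    by rewrite E' commgEl !conjgE !mulgA !mulgK mulgV mul1g.
  - by move=> H; exists i; [exact: ltnW|rewrite addSnnS].
exists (mulset [set z ^- i | i in `I_N.+1] (V `&` A)); split.
- apply: compact_mulset; last exact: compact_closedI.
  by apply: finite_compact; apply: finite_image; exact: finite_II.
- move=> _ [_ [i _ <-] [v [_ Av] <-]]; apply: sgM => //.
  by apply: sgV => //; exact: AX.
- move=> m; have [i iN [v VAv [b Bb E]]] := hit m.
  exists (z ^- i * v).
    by exists (z ^- i); [exists i|exists v].
  exists b => //; rewrite -mulgA E addnC expgnDr mulgA mulVg mul1g //.
Qed.

(* Schreier's argument: [B] is generated by [H], [K^-1 W K :&: B] and
   [K :&: B]. *)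
Lemma cocompact_comp_gen H B B' W K :
  closed B -> closed B' -> is_subgroup H -> is_subgroup B -> is_subgroup B' ->
  H `<=` B -> B `<=` B' -> abelian_mod B' H ->
  compact W -> W `<=` B' -> B' `<=` stable_gen [::] (W `|` H) ->
  compact K -> B' `<=` mulset K B -> comp_gen [::] H B.
Proof.
move=> clB clB' sH sB sB' HB BB' aBH cW WB' B'gen cK B'K.
(* As [B] lies in [B'], cutting [K] down to [B'] still covers [B'] modulo [B]; adjoining [1] puts
   [1] into [K1 M]. *)
pose K1 := (K `&` B') `|` [set 1].
have cK1 : compact K1.
  by apply: compactU; [exact: compact_closedI|exact: compact_set1].
have K1B' : K1 `<=` B' by move=> _ [[//]|->]; exact: sg1.
have B'K1 x : B' x -> mulset K1 B x.
  move=> B'x; have [k Kk [b Bb E]] := B'K _ B'x.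
  exists k; last by exists b.
  left; split=> //; apply: (sgMr sB' (BB' _ Bb)); rewrite E //.
pose S := W `|` [set x^-1 | x in W].
have cS : compact S by apply: compactU => //; exact: compact_inv.
have SB' : S `<=` B' by move=> _ [/WB'//|[x /WB' Bx <-]]; exact: sgV.
pose WB := mulset (mulset [set x^-1 | x in K1] S) K1 `&` B.
have cWB : compact WB.
  apply: compact_closedI => //; apply: compact_mulset => //.
  by apply: compact_mulset => //; exact: compact_inv.
have cK1B : compact (K1 `&` B) by exact: compact_closedI.
exists (WB `|` (K1 `&` B)); split; first exact: compactU.
  by move=> x [[]|[]].
set M := stable_gen _ _.
have sM : is_subgroup M by exact: subgroup_stable_gen.
have HM : H `<=` M by move=> x Hx; apply: sub_stable_gen; right.
have WM : WB `<=` M by move=> x Wx; apply: sub_stable_gen; left; left.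
have KM : K1 `&` B `<=` M by move=> x Kx; apply: sub_stable_gen; left; right.
have MB : M `<=` B.
  by apply: stable_gen_min => // x [[[]//|[]//]|]; exact: HB.
have stepS s y : S s -> mulset K1 M y -> mulset K1 M (s * y).
  move=> Ss [k Kk [m Mm <-]].
  have [k' Kk' [b Bb E]] := B'K1 (s * k) (sgM sB' (SB' _ Ss) (K1B' _ Kk)).
  exists k' => //; exists (b * m); last by rewrite mulgA E mulgA.
  apply: (sgM sM) => //; apply: WM; split=> //.
  exists (k'^-1 * s).
    by exists k'^-1; [exists k'|exists s].
  by exists k => //; rewrite -mulgA -E mulKg.
have stepH h y : H h -> mulset K1 M y -> mulset K1 M (h * y).
  move=> Hh [k Kk [m Mm <-]]; exists k => //; exists (h ^ k * m).
    apply: (sgM sM) => //; apply: HM; apply: (abelian_mod_conj aBH) => //.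
      exact: subset_trans BB'.
    exact: K1B'.
  by rewrite conjgE !mulgA mulgV mul1g.
(* These [x] form a subgroup containing the generators, so [B'] preserves [K1 M]. Applied to [1],
   this writes each [b] in [B] as [k * m], and then [k] lies in [K1 :&: B]. *)
have B'M : B' `<=` [set x | forall y, mulset K1 M y ->
    mulset K1 M (x * y) /\ mulset K1 M (x^-1 * y)].
  apply: subset_trans B'gen _; apply: stable_gen_min => //.
  - split.
    + by move=> y; rewrite invg1 mul1g.
    + move=> x x' Px Px' y Ky; rewrite invgM -!mulgA; split.
        by apply: (Px _ _).1; apply: (Px' _ _).1.
      by apply: (Px' _ _).2; apply: (Px _ _).2.
    + by move=> x Px y Ky; rewrite invgK; have [] := Px _ Ky.
  - move=> x [Wx|Hx] y Ky; split.
    + by apply: stepS => //; left.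
    + by apply: stepS => //; right; exists x.
    + exact: stepH.
    + by apply: stepH => //; exact: sgV.
move=> b Bb.
have [|k Kk [m Mm]] := (B'M b (BB' _ Bb) 1 _).1.
  by exists 1; [right|exists 1; [exact: sg1|rewrite mulg1]].
rewrite mulg1 => E; rewrite -E; apply: (sgM sM) => //; apply: KM; split=> //.
by apply: (sgMr sB (MB _ Mm)); rewrite E.
Qed.

Lemma stable_gen_finitary B z x : stable_gen [::] ([set z] `|` B) x ->
  exists F, (forall f, f \in F -> B f) /\ stable_gen [::] ([set z] `|` [set` F]) x.
Proof.
move: x; apply: stable_gen_min.
- split.
  + by exists [::]; split=> //; apply: sg1; exact: subgroup_stable_gen.
  + move=> u v [F [FB Fu]] [F' [FB' Fv]]; exists (F ++ F'); split.
      by move=> f; rewrite mem_cat => /orP[/FB|/FB'].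
    apply: (sgM (subgroup_stable_gen _ _)).
      move: u Fu; apply: stable_genS => y [->|/= yF]; apply: sub_stable_gen.
        by left.
      by right; rewrite /= mem_cat yF.
    move: v Fv; apply: stable_genS => y [->|/= yF]; apply: sub_stable_gen.
      by left.
    by right; rewrite /= mem_cat yF orbT.
  + move=> u [F [FB Fu]]; exists F; split=> //.
    by exact: (sgV (subgroup_stable_gen _ _)).
- by [].
- move=> y [->|By].
    by exists [::]; split=> //; apply: sub_stable_gen; left.
  exists [:: y]; split; first by move=> f; rewrite inE => /eqP ->.
  by apply: sub_stable_gen; right; rewrite /= inE.
Qed.

(** [M] contains the commutators of [A], so it is normal in [A] and the subgroup generated by [z]
    and [M] is [<z> M]. *)
Lemma gen_powers A M z x : is_subgroup A -> is_subgroup M -> M `<=` A ->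
  abelian_mod A M -> A z -> stable_gen [::] ([set z] `|` M) x ->
  exists n, exists2 m, M m & x = z ^+ n * m \/ x = z ^- n * m.
Proof.
move=> sA sM MA aAM Az.
have nM m a : M m -> A a -> M (m ^ a) by exact: (abelian_mod_conj aAM sM).
have AX n p : A (z ^+ n * z ^- p).
  by apply: sgM => //; [exact: sgX|apply: sgV => //; exact: sgX].
have czV n p : z ^- p * z ^+ n = z ^+ n * z ^- p.
  rewrite -[LHS](mulgK (z ^+ p)) -[z ^- p * _ * _]mulgA -expgnDr addnC.
  by rewrite expgnDr mulgA mulVg mul1g.
(* The form [z ^+ n * z ^- p] of an integer power is stable under products and inverses without sign
   cases. *)
move=> gx; suff [n [p [m Mm ->]]] :
    exists n p, exists2 m, M m & x = z ^+ n * z ^- p * m.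
  case: (leqP p n) => [pn|/ltnW np].
    by exists (n - p)%N, m => //; left; rewrite expgnFr.
  exists (p - n)%N, m => //; right; congr (_ * _).
  by rewrite expgnFr // invgM invgK.
move: x gx; apply: stable_gen_min => //; last first.
  move=> y [->|My]; first by exists 1%N, 0%N, 1; [exact: sg1|rewrite invg1 !mulg1].
  by exists 0%N, 0%N, y => //; rewrite invg1 !mul1g.
split.
- by exists 0%N, 0%N, 1; [exact: sg1|rewrite invg1 !mulg1].
- move=> _ _ [n [p [m Mm ->]]] [n' [p' [m' Mm' ->]]].
  exists (n + n')%N, (p' + p)%N, (m ^ (z ^+ n' * z ^- p') * m').
    by apply: sgM => //; exact: nM.
  have -> : z ^+ (n + n') * z ^- (p' + p) = z ^+ n * z ^- p * (z ^+ n' * z ^- p').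
    by rewrite !expgnDr invgM !mulgA -[_ * z ^- p * z ^+ n']mulgA czV !mulgA.
  move: (z ^+ n' * z ^- p') (z ^+ n * z ^- p) => c d.
  by rewrite conjgE !mulgA mulgK.
- move=> _ [n [p [m Mm ->]]]; exists p, n, (m^-1 ^ (z ^+ p * z ^- n)).
    by apply: nM => //; exact: sgV.
  by rewrite -conjgC !invgM invgK mulgA.
Qed.

(* The induction hypothesis, applied modulo [<z>], shows that the closure [B']
   of [<z> B] is compactly generated.  By Weil's lemma in [B' / B], either [B]
   is cocompact in [B'], or [B] meets only finitely many translates
   [V z^n M]. *)
Lemma closed_comp_gen_abelian E : forall H A B W V,
  compact V -> nbhs (1 : G) V -> (forall x, V x -> V x^-1) ->
  closed A -> closed B -> is_subgroup H -> is_subgroup A -> is_subgroup B ->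
  H `<=` B -> B `<=` A -> abelian_mod A H -> compact W ->
  [set` E] `<=` A -> A `<=` mulset W (stable_gen [::] ([set` E] `|` H)) ->
  comp_gen [::] H B.
Proof.
elim: E => [|z E IH] H A B W V cV V1 Vsym clA clB sH sA sB HB BA aAH cW EA AW.
  (* Here [A] lies in [W H], and [H <= B] puts the [W]-factor of an element of [B] into [B]. *)
  exists (W `&` B); split; [exact: compact_closedI|exact: subIsetr|].
  move=> b Bb; have [w Ww [h]] := AW _ (BA _ Bb).
  move=> /(stable_gen_min sH (@conj_stable_nil _ H)) Hh E.
  have {}Hh : H h by apply: Hh => x [].
  have Bw : B w by apply: (sgMr sB (HB _ Hh)); rewrite E.
  rewrite -E; apply: (sgM (subgroup_stable_gen _ _)); apply: sub_stable_gen.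
    by left.
  by right.
have Az : A z by apply: EA; rewrite /= mem_head.
pose gen X := stable_gen [::] X.
have sgen X : is_subgroup (gen X) by exact: subgroup_stable_gen.
pose H' := gen ([set z] `|` H).
pose D := gen ([set z] `|` B).
pose B' := closure D.
have HA : H `<=` A by exact: subset_trans BA.
have DA : D `<=` A by apply: stable_gen_min => // x [->|/BA].
have B'A : B' `<=` A by exact: closure_min.
have DB' : D `<=` B' by exact: subset_closure.
have BB' : B `<=` B' by move=> x Bx; apply: DB'; apply: sub_stable_gen; right.
have B'z : B' z by apply: DB'; apply: sub_stable_gen; left.
have HB' : H `<=` B' by exact: subset_trans BB'.
have sB' : is_subgroup B' by apply: subgroup_closure; exact: sgen.
have clB' : closed B' by exact: closed_closure.
have HH' : H `<=` H' by move=> x Hx; apply: sub_stable_gen; right.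
have H'B' : H' `<=` B' by apply: stable_gen_min => // x [->|/HB'].
have aB'H : abelian_mod B' H.
  exact: (abelian_mod_sub B'A (@subset_refl _ H) aAH).
have [W' [cW' W'B' B'W']] : comp_gen [::] H' B'.
  apply: (IH H' A B' W V) => //.
  - exact: sgen.
  - exact: (abelian_mod_sub (@subset_refl _ A) HH' aAH).
  - by move=> x xE; apply: EA; rewrite /= inE xE orbT.
  - apply: subset_trans AW _; apply: mulsetS => //; apply: stable_genS.
    move=> x [/=|Hx]; last by apply: sub_stable_gen; right; exact: HH'.
    rewrite inE => /predU1P[->|xE]; last by apply: sub_stable_gen; left.
    by apply: sub_stable_gen; right; apply: sub_stable_gen; left.
(* Adjoining [z] turns generation modulo [H'] into generation modulo [H]. *)
pose W2 := W' `|` [set z].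
have cW2 : compact W2 by apply: compactU => //; exact: compact_set1.
have W2B' : W2 `<=` B' by move=> x [/W'B'|->].
have B'W2 : B' `<=` gen (W2 `|` H).
  apply: subset_trans B'W' _; apply: stable_genS => x [W'x|].
    by apply: sub_stable_gen; left; left.
  apply: stable_genS => y [->|Hy]; apply: sub_stable_gen; last by right.
  by left; right.
have [F [FD FM]] := @dense_generators [::] B' D W2 H V clB' sB'
  (@conj_stable_nil _ _) cV V1 Vsym cW2 W2B' B'W2 DB' (@subset_refl _ _).
(* [F] lies in the group generated by [z] and [B], hence in one generated by [z] and finitely many
   elements of [B]. *)
have [FB [FBB FFB]] : exists FB : seq G, (forall f, f \in FB -> B f) /\
    forall f, f \in F -> gen ([set z] `|` [set` FB]) f.
  elim: F FD {FM} => [|f F IHF] FD; first by exists [::].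
  have [|FB [FBB FFB]] := IHF.
    by move=> g gF; apply: FD; rewrite inE gF orbT.
  have [F1 [F1B F1f]] := stable_gen_finitary (FD _ (mem_head _ _)).
  exists (F1 ++ FB); split; first by move=> g; rewrite mem_cat => /orP[/F1B|/FBB].
  move=> g; rewrite inE => /predU1P[->|/FFB gFB].
    move: f F1f {FD}; apply: stable_genS => y [->|/= yF]; apply: sub_stable_gen.
      by left.
    by right; rewrite /= mem_cat yF.
  move: g gFB; apply: stable_genS => y [->|/= yF]; apply: sub_stable_gen.
    by left.
  by right; rewrite /= mem_cat yF orbT.
pose M := gen ([set` FB] `|` H).
have MB : M `<=` B by apply: stable_gen_min => // x [/FBB|/HB].
have HM : H `<=` M by move=> x Hx; apply: sub_stable_gen; right.
pose M' := gen ([set z] `|` M).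
have B'VM : B' `<=` mulset (V `&` B') M'.
  have M'B' : M' `<=` B' by apply: stable_gen_min => // x [->|/MB/BB'].
  have HM' : H `<=` M' by move=> x Hx; apply: sub_stable_gen; right; exact: HM.
  apply: FM => //; first exact: sgen.
    by move=> m n; apply: (abelian_mod_conj aB'H) => //; exact: sgen.
  move=> f /FFB; apply: stable_genS => y [->|yF]; apply: sub_stable_gen.
    by left.
  by right; apply: sub_stable_gen; left.
have {}B'VM x : B' x -> exists u, [/\ V u, B' u & exists n, exists2 m, M m &
    x = u * (z ^+ n * m) \/ x = u * (z ^- n * m)].
  move=> /B'VM[u [Vu B'u] [m' M'm' <-]]; exists u; split=> //.
  have [n [m Mm E']] := gen_powers sB' (sgen _) (subset_trans MB BB')
    (abelian_mod_sub (@subset_refl _ _) HM aB'H) B'z M'm'.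
  by exists n, m => //; case: E' => ->; [left|right].
have aB'B : abelian_mod B' B by exact: (abelian_mod_sub B'A HB aAH).
have nB b a : B b -> B' a -> B (b ^ a) by exact: (abelian_mod_conj aB'B sB).
have cVB' : compact (V `&` B') by exact: compact_closedI.
have [[K [cK KB' zK]]|proper] :=
  powers_precompact_or_proper clB' sB' sB BB' aB'B cV V1 B'z.
  (* All powers of [z], of either sign, lie in [K2 B], so [V K2] covers [B'] modulo [B]. *)
  pose K2 := K `|` [set x^-1 | x in K].
  have cK2 : compact K2 by apply: compactU => //; exact: compact_inv.
  apply: (cocompact_comp_gen (W := W2) (K := mulset V K2) clB clB') => //.
    exact: compact_mulset.
  move=> x /B'VM[u [Vu B'u [n [m /MB Bm xE]]]].
  have [k Kk [b Bb Ekb]] := zK n; case: xE => ->; rewrite -Ekb.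
    exists (u * k); first by exists u => //; exists k => //; left.
    by exists (b * m); [exact: sgM|rewrite !mulgA].
  exists (u * k^-1); first by exists u => //; exists k^-1 => //; right; exists k.
  exists (b^-1 ^ k^-1 * m).
    apply: (sgM sB) => //; apply: nB; first exact: sgV.
    by apply: (sgV sB') => //; exact: KB'.
  by rewrite conjgE invgK invgM !mulgA mulgVK.
(* If [b = u * z ^+ n * m], then [z ^+ n] lies in [u^-1 B], so properness for [V :&: B'] bounds [n];
   for [z ^- n] one inverts. *)
have [k kP] := proper _ cVB' (@subIsetr _ _ _).
pose Zk := [set z ^+ i | i in `I_k] `|` [set z ^- i | i in `I_k].
have cZk : compact Zk.
  by apply: compactU; apply: finite_compact; apply: finite_image; exact: finite_II.
exists ((mulset V Zk `&` B) `|` [set` FB]); split.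
- apply: compactU; last exact: compact_seq.
  by apply: compact_closedI => //; exact: compact_mulset.
- by move=> x [[]//|/FBB].
move=> b Bb; have [u [Vu B'u [n [m Mm bE]]]] := B'VM _ (BB' _ Bb).
have Bbm : B (b * m^-1) by apply: (sgM sB) => //; apply: (sgV sB); exact: MB.
have nk : (n < k)%N.
  apply: kP; case: bE => bE.
    exists u^-1; first by split; [exact: Vsym|exact: (sgV sB')].
    by exists (b * m^-1) => //; rewrite bE !mulgA mulVg mul1g mulgK.
  exists u => //; exists ((b * m^-1)^-1 ^ u).
    by apply: nB => //; exact: sgV.
  by rewrite conjgE bE !invgM !invgK !mulgA mulgV mul1g mulgV mul1g mulgVK.
have -> : b = b * m^-1 * m by rewrite mulgVK.
apply: (sgM (sgen _)); last first.
  move: m Mm {bE Bbm}; apply: stable_genS => y [yF|Hy]; apply: sub_stable_gen.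
    by left; right.
  by right.
apply: sub_stable_gen; left; left; split=> //; exists u => //.
case: bE => ->.
  by exists (z ^+ n); [left; exists n|rewrite !mulgA mulgK].
by exists (z ^- n); [right; exists n|rewrite !mulgA mulgK].
Qed.

(** Taking [D = A] in [dense_generators] makes the group generated by [H] and finitely many elements
    cocompact in [A], which allows induction on a finite list of generators. *)
Lemma comp_gen_abelian H A B V :
  compact V -> nbhs (1 : G) V -> (forall x, V x -> V x^-1) ->
  closed A -> closed B -> is_subgroup H -> is_subgroup A -> is_subgroup B ->
  H `<=` B -> B `<=` A -> abelian_mod A H ->
  comp_gen [::] H A -> comp_gen [::] H B.
Proof.
move=> cV V1 Vsym clA clB sH sA sB HB BA aAH [W [cW WA AW]].
have [F [FA FM]] := @dense_generators [::] A A W H V clA sA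
  (@conj_stable_nil _ _) cV V1 Vsym cW WA AW (@subset_refl _ _)
  (@subset_closure _ _).
have HA := subset_trans HB BA.
apply: (closed_comp_gen_abelian (E := F) (W := V `&` A) cV V1 Vsym clA) => //.
  exact: compact_closedI.
have sM : is_subgroup (stable_gen [::] ([set` F] `|` H)).
  exact: subgroup_stable_gen.
have MA : stable_gen [::] ([set` F] `|` H) `<=` A.
  by apply: stable_gen_min => // x [/FA|/HA].
have HM : H `<=` stable_gen [::] ([set` F] `|` H).
  by move=> x Hx; apply: sub_stable_gen; right.
apply: FM => //.
  by move=> m n; exact: (abelian_mod_conj aAH).
by move=> f fF; apply: sub_stable_gen; left.
Qed.

End CompactGeneration.

(** * Closed submodules under a commutative conjugation action *)

Section ClosedSubmodules.
Variable G : topGroupType.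
Implicit Types (x y z g : G) (B C D K M N U V W X : set G).
Implicit Types (E F gs : seq G).

Variables (A H V : set G).
Hypotheses (sgA : is_subgroup A) (sgH : is_subgroup H).
Hypotheses (nH : forall x g, H x -> H (x ^ g)) (commA : forall x y, A [~ x, y]).
Hypothesis aAH : abelian_mod A H.
Hypotheses (cV : compact V) (V1 : nbhs (1 : G) V).
Hypothesis Vsym : forall x, V x -> V x^-1.

Definition submodule gs M :=
  [/\ is_subgroup M, conj_stable gs M, H `<=` M & M `<=` A].

Lemma normalA x g : A x -> A (x ^ g).
Proof. exact: normal_of_commutators. Qed.

(** [g * h] and [h * g] differ by a commutator, which lies in [A] and so acts trivially on [A]
    modulo [H]: the conjugation action there is commutative. *)
Lemma conj_swap M x g h : is_subgroup M -> H `<=` M -> A x ->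
  M (x ^ (g * h)) -> M (x ^ (h * g)).
Proof.
move=> sM HM Ax; rewrite [h * g]commgC (conjgM x (g * h)).
move: (x ^ (g * h)) (normalA (g * h) Ax) => y Ay My.
rewrite -[_ ^ [~ _, _]](mulKg y^-1) invgK -commgEl.
by apply: sgM => //; apply: HM; exact: aAH.
Qed.

Lemma submodule_setI gs M N : submodule gs M -> submodule gs N ->
  submodule gs (M `&` N).
Proof.
move=> [sM tM HM MA] [sN tN HN NA]; split.
- exact: subgroup_setI.
- by move=> g x ggs [/(tM _ _ ggs)[? ?] /(tN _ _ ggs)[? ?]].
- by move=> x Hx; split; [exact: HM|exact: HN].
- by move=> x [/MA].
Qed.

(** By commutativity of the action, [x |-> x ^ g] is a module automorphism of [A] modulo [H]. *)
Lemma submodule_preconj gs M g : submodule gs M ->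
  submodule gs [set x | M (x ^ g)].
Proof.
move=> [sM tM HM MA]; split.
- split; first by rewrite /= conj1g; exact: sg1.
    by move=> x y /= Mx My; rewrite conjMg; exact: sgM.
  by move=> x /= Mx; rewrite conjVg; exact: sgV.
- move=> h x hgs /= Mx; have [M1 M2] := tM _ _ hgs Mx.
  have Ax : A x by rewrite -[x](conjgK g); apply: normalA; exact: MA.
  by split; rewrite -conjgM; apply: conj_swap => //; rewrite conjgM.
- by move=> x Hx /=; apply: HM; exact: nH.
- by move=> x /MA Axg; rewrite -[x](conjgK g); exact: normalA.
Qed.

Lemma submodule_mulset gs M N : submodule gs M -> submodule gs N ->
  submodule gs (mulset M N).
Proof.
move=> [sM tM HM MA] [sN tN HN NA].
have nN n a : N n -> A a -> N (n ^ a) by exact: (abelian_mod_conj aAH sN).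
split.
- split.
  + by exists 1; [exact: sg1|exists 1; [exact: sg1|rewrite mulg1]].
  + move=> _ _ [m Mm [n Nn <-]] [m' Mm' [n' Nn' <-]].
    exists (m * m'); first exact: sgM.
    exists (n ^ m' * n'); last by rewrite conjgE !mulgA mulgK.
    by apply: sgM => //; apply: nN => //; exact: MA.
  + move=> _ [m Mm [n Nn <-]]; exists m^-1; first exact: sgV.
    exists (n^-1 ^ m^-1); last by rewrite conjgE invgK invgM !mulgA mulVg mul1g.
    by apply: nN; [exact: sgV|apply: sgV => //; exact: MA].
- move=> g _ ggs [m /(tM _ _ ggs)[? ?] [n /(tN _ _ ggs)[? ?] <-]].
  rewrite !conjMg; split; first by exists (m ^ g) => //; exists (n ^ g).
  by exists (m ^ g^-1) => //; exists (n ^ g^-1).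
- by move=> h Hh; exists h; [exact: HM|exists 1; [exact: sg1|rewrite mulg1]].
- by move=> _ [m /MA Am [n /NA An <-]]; exact: sgM.
Qed.

Lemma submodule_stable_gen gs X : X `<=` A -> H `<=` A ->
  submodule gs (stable_gen gs (X `|` H)).
Proof.
move=> XA HA; split.
- exact: subgroup_stable_gen.
- exact: conj_stable_gen.
- by move=> x Hx; apply: sub_stable_gen; right.
- apply: stable_gen_min => // [g x _ Ax|x [/XA|/HA]//].
  by split; exact: normalA.
Qed.

Lemma comp_gen_preconj gs M g : submodule gs M -> comp_gen gs H M ->
  comp_gen gs H [set x | M (x ^ g)].
Proof.
move=> [sM tM HM MA] [W [cW WM MW]].
have WA := subset_trans WM MA; have HA := subset_trans HM MA.
exists [set x ^ g^-1 | x in W]; split; first exact: compact_conj.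
  by move=> _ [x Wx <-] /=; rewrite conjgKV; exact: WM.
have W'A : [set x ^ g^-1 | x in W] `<=` A.
  by move=> _ [x /WA Ax <-]; exact: normalA.
have subW := submodule_stable_gen gs W'A HA.
have [sW tW HW AW] := submodule_preconj g^-1 subW.
move=> x /= /MW; rewrite -{2}[x](conjgK g); move: (x ^ g).
apply: (stable_gen_min sW tW) => y [Wy|/HW//].
by apply: sub_stable_gen; left; exists y.
Qed.

Lemma comp_gen_mulset gs M N : is_subgroup M -> is_subgroup N ->
  comp_gen gs H M -> comp_gen gs H N -> comp_gen gs H (mulset M N).
Proof.
move=> sM sN [W [cW WM MW]] [W' [cW' W'N NW']].
exists (W `|` W'); split; first exact: compactU.
  move=> x [/WM Mx|/W'N Nx].
    by exists x => //; exists 1; [exact: sg1|rewrite mulg1].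
  by exists 1; [exact: sg1|exists x => //; rewrite mul1g].
move=> _ [m /MW Gm [n /NW' Gn <-]]; apply: (sgM (subgroup_stable_gen _ _)).
  move: m Gm; apply: stable_genS => y [Wy|Hy]; apply: sub_stable_gen.
    by left; left.
  by right.
move: n Gn; apply: stable_genS => y [Wy|Hy]; apply: sub_stable_gen.
  by left; right.
by right.
Qed.

(* The elements of [B0] viewed as coefficients, [poly_le B0 g n] is the set of
   polynomials of degree at most [n] in the automorphism [x |-> x ^ g]. *)
Fixpoint poly_le (B0 : set G) g n : set G :=
  if n is m.+1 then mulset (poly_le B0 g m) [set x | B0 (x ^ (g ^- n))] else B0.

(** * Polynomials in one conjugation automorphism *)

Section PolyLe.
Variables (gs : seq G) (B0 : set G) (g : G).
Hypothesis subB0 : submodule gs B0.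

Lemma submodule_poly_le n : submodule gs (poly_le B0 g n).
Proof.
elim: n => [//|n IH]; apply: submodule_mulset => //.
exact: submodule_preconj.
Qed.

Lemma comp_gen_poly_le n : comp_gen gs H B0 -> comp_gen gs H (poly_le B0 g n).
Proof.
move=> gB0; elim: n => [//|n IH]; apply: comp_gen_mulset => //.
- by case: (submodule_poly_le n).
- by case: (submodule_preconj (g ^- n.+1) subB0).
- exact: comp_gen_preconj.
Qed.

Lemma poly_leS n : poly_le B0 g n `<=` poly_le B0 g n.+1.
Proof.
move=> x Px; exists x => //; exists 1; last by rewrite mulg1.
by rewrite /= conj1g; case: subB0 => /sg1.
Qed.

Lemma poly_le_mono m n : (m <= n)%N -> poly_le B0 g m `<=` poly_le B0 g n.
Proof.
move=> /subnK <-; elim: (n - m)%N => [//|k IH].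
by apply: subset_trans IH _; exact: poly_leS.
Qed.

Lemma monomial_poly_le n x : B0 x -> poly_le B0 g n (x ^ (g ^+ n)).
Proof.
case: n => [|n] B0x; first by rewrite conjg1.
exists 1; first by case: (submodule_poly_le n) => /sg1.
by exists (x ^ (g ^+ n.+1)); [rewrite /= conjgK|rewrite mul1g].
Qed.

Lemma poly_le_conj n x : poly_le B0 g n x -> poly_le B0 g n.+1 (x ^ g).
Proof.
elim: n x => [|n IH] x; first by move=> /(@monomial_poly_le 1).
move=> [y Py [u /= Bu <-]]; rewrite conjMg; exists (y ^ g); first exact: IH.
exists (u ^ g) => //=.
by rewrite -conjgM [g ^+ n.+2]expgSr invgM mulgA mulgV mul1g.
Qed.

Lemma poly_le_conjX n k x : poly_le B0 g n x ->
  poly_le B0 g (n + k) (x ^ (g ^+ k)).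
Proof.
move=> Px; elim: k => [|k IH]; first by rewrite addn0 conjg1.
by rewrite addnS expgSr conjgM; exact: poly_le_conj.
Qed.

Lemma poly_le_sub n B : B0 `<=` B -> is_subgroup B -> conj_stable (g :: gs) B ->
  poly_le B0 g n `<=` B.
Proof.
move=> B0B sB tB; elim: n => [//|n IH] _ [x Px [y /= By <-]].
apply: sgM => //; first exact: IH.
rewrite -[y](conjgKV (g ^+ n.+1)).
by apply: conj_stableX tB _; exact: B0B.
Qed.

(** Elements of [B] are Laurent polynomials in the action of [g] with coefficients in [B0]; a high
    power of [g] clears the negative exponents. *)
Lemma exhaust_poly_le B W : W `<=` B0 ->
  B `<=` stable_gen (g :: gs) (W `|` H) ->
  forall x, B x -> exists n k, poly_le B0 g n (x ^ (g ^+ k)).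
Proof.
move=> WB0 Bgen x /Bgen; have [sB0 tB0 HB0 B0A] := subB0.
have sP n : is_subgroup (poly_le B0 g n) by case: (submodule_poly_le n).
(* Membership in [A] is carried along for [conj_swap], which moves the operators in [gs] past
   [g ^+ k]. *)
move=> gx; suff [] : A x /\ exists n k, poly_le B0 g n (x ^ (g ^+ k)) by [].
move: x gx; apply: stable_gen_min.
- split.
  + by split; [exact: sg1|exists 0%N, 0%N; rewrite conj1g; exact: sg1].
  + move=> x y [Ax [n [k Px]]] [Ay [n' [k' Py]]]; split; first exact: sgM.
    exists (maxn (n + k') (n' + k))%N, (k + k')%N; rewrite conjMg.
    apply: sgM => //.
      rewrite expgnDr conjgM; apply: (poly_le_mono (leq_maxl _ _)).
      exact: poly_le_conjX.
    rewrite [(k + k')%N]addnC expgnDr conjgM; apply: (poly_le_mono (leq_maxr _ _)).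
    exact: poly_le_conjX.
  + move=> x [Ax [n [k Px]]]; split; first exact: sgV.
    by exists n, k; rewrite conjVg; exact: sgV.
- move=> h x hgs [Ax [n [k Px]]]; split; (split; first exact: normalA).
    move: hgs; rewrite inE => /predU1P[->|hgs].
      exists n.+1, k; rewrite -conjgM -expgS expgSr conjgM.
      exact: poly_le_conj.
    have [_ tP HP PA] := submodule_poly_le n.
    exists n, k; rewrite -conjgM; apply: conj_swap => //.
    by rewrite conjgM; exact: (tP _ _ hgs Px).1.
  move: hgs; rewrite inE => /predU1P[->|hgs].
    by exists n, k.+1; rewrite -conjgM expgS mulKg.
  have [_ tP HP PA] := submodule_poly_le n.
  exists n, k; rewrite -conjgM; apply: conj_swap => //.
  by rewrite conjgM; exact: (tP _ _ hgs Px).2.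
- move=> x xWH; have B0x : B0 x by case: xWH => [/WB0|/HB0].
  by split; [exact: B0A|exists 0%N, 0%N; rewrite conjg1].
Qed.

End PolyLe.

Lemma conj_stable_behead g gs M : conj_stable (g :: gs) M -> conj_stable gs M.
Proof. by move=> tM h x hgs; apply: tM; rewrite inE hgs orbT. Qed.

Lemma stable_gen_cons g gs X : stable_gen gs X `<=` stable_gen (g :: gs) X.
Proof.
apply: stable_gen_min; first exact: subgroup_stable_gen.
  by apply: (@conj_stable_behead g); exact: conj_stable_gen.
exact: sub_stable_gen.
Qed.

(* Hilbert's basis theorem: the leading coefficients of degree [n] of the
   elements of [C] form an increasing sequence of open submodules of [B0]. *)
Theorem closed_submodule_comp_gen gs B C :
  submodule gs B -> submodule gs C -> closed B -> closed C -> C `<=` B ->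
  comp_gen gs H B -> comp_gen gs H C.
Proof.
elim: gs B C => [|g gs IH] B C [sB tB HB BA] [sC tC HC CA] clB clC CB.
  apply: (comp_gen_abelian cV V1 Vsym) => //.
  exact: (abelian_mod_sub BA (@subset_refl _ H)).
move=> [W [cW WB BW]].
have HA := subset_trans HB BA.
(* Including [V :&: B] makes [B0], and with it every [poly_le B0 g n], open in [B] and therefore
   closed. *)
pose W0 := W `|` (V `&` B).
have cW0 : compact W0 by apply: compactU => //; exact: compact_closedI.
have W0B : W0 `<=` B by move=> x [/WB|[]].
pose B0 := stable_gen gs (W0 `|` H).
have subB0 : submodule gs B0.
  by apply: submodule_stable_gen => //; exact: subset_trans BA.
have tB' := conj_stable_behead tB.
have tC' := conj_stable_behead tC.
have B0B : B0 `<=` B by apply: stable_gen_min => // x [/W0B|/HB].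
have WB0 : W `<=` B0 by move=> x Wx; apply: sub_stable_gen; left; left.
have VB0 : V `&` B `<=` B0 by move=> x Vx; apply: sub_stable_gen; left; right.
have gB0 : comp_gen gs H B0.
  by exists W0; split=> // x Wx; apply: sub_stable_gen; left.
have subP := submodule_poly_le g subB0.
have PB n : poly_le B0 g n `<=` B by exact: (poly_le_sub (gs := gs)).
have clP n : closed (poly_le B0 g n).
  have [sP _ _ _] := subP n.
  apply: (subgroup_relopen_closed clB sP sB (PB n) V1).
  by apply: subset_trans VB0 _; exact: (poly_le_mono subB0 (leq0n n)).
(* [a] is in [L n] when [a ^ (g ^+ n.+1)] reduces modulo [C] to degree at most [n], that is, when
   [a] is the coefficient of degree [n.+1] of an element of [C]. *)
pose S n := mulset (poly_le B0 g n) C.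
pose L n := B0 `&` [set a | S n (a ^ (g ^+ n.+1))].
have subL n : submodule gs (L n).
  apply: submodule_setI => //; apply: submodule_preconj.
  by apply: submodule_mulset.
have LS n : L n `<=` L n.+1.
  move=> a [B0a [x Px [c Cc E]]]; split=> //=.
  exists (x ^ g); first exact: (poly_le_conj subB0).
  exists (c ^ g); first by apply: (tC _ _ _ Cc).1; exact: mem_head.
  by rewrite [g ^+ n.+2]expgSr conjgM -E conjMg.
have Lmono m n : (m <= n)%N -> L m `<=` L n.
  move=> /subnK <-; elim: (n - m)%N => [//|k IHk].
  by apply: subset_trans IHk _; exact: LS.
pose Loo := \bigcup_n L n.
have LooB0 : Loo `<=` B0 by move=> x [n _ []].
have [sB0 tB0 HB0 B0A] := subB0.
have subLoo : submodule gs Loo.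
  split.
  - split; first by exists 0%N => //; case: (subL 0%N) => /sg1.
      move=> x y [n _ Lx] [m _ Ly]; exists (maxn n m) => //.
      have [sL _ _ _] := subL (maxn n m).
      by apply: (sgM sL); [apply: Lmono Lx; exact: leq_maxl|
        apply: Lmono Ly; exact: leq_maxr].
    by move=> x [n _ Lx]; exists n => //; case: (subL n) => /sgV + _ _ _; exact.
  - move=> h x hgs [n _ Lx]; have [_ tL _ _] := subL n.
    by have [? ?] := tL _ _ hgs Lx; split; exists n.
  - by move=> x Hx; exists 0%N => //; case: (subL 0%N) => _ _ + _; exact.
  - exact: subset_trans B0A.
(* For [x] in [V' :&: B], [x ^ g] is itself in [B0], so [x] is in [L 0]; hence every [L n] is open
   in [B]. *)
pose V' := V `&` [set y | V (y ^ g)].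
have V'1 : nbhs (1 : G) V' by apply: filterI => //; exact: nbhs1_conj.
have V'L : V' `&` B `<=` L 0%N.
  move=> x [[Vx Vxg] Bx]; split; first exact: VB0.
  exists (x ^ g); last by exists 1; [exact: sg1|rewrite mulg1].
  by apply: VB0; split=> //; apply: (tB _ _ _ Bx).1; exact: mem_head.
have LooB := subset_trans LooB0 B0B.
have [sLoo _ _ _] := subLoo.
have clLoo : closed Loo.
  apply: (subgroup_relopen_closed clB sLoo sB LooB V'1) => x /V'L Lx.
  by exists 0%N.
have clB0 : closed B0 by exact: (clP 0%N).
have [WL [cWL WLL LWL]] := IH _ _ subB0 subLoo clB0 clLoo LooB0 gB0.
(* Finitely many translates of [V'] by elements of [Loo] cover the compact generators of [Loo]; one
   [L n0] contains these elements as well as [V' :&: B]. *)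
have [n0 Ln0] : exists n0, Loo `<=` L n0.
  have WLcl : WL `<=` closure Loo by apply: subset_trans WLL _; exact: subset_closure.
  have [F [FL FW]] := compact_translates cWL WLcl V'1.
  have [f /FL[n _ Lf]|n0 Hn0] := @uniform_bound _ F (fun f n => L n f).
    by exists n.
  exists n0; have [sL tL HL _] := subL n0.
  apply: subset_trans LWL _; apply: stable_gen_min => // w [Ww|/HL//].
  have [f fF Vf] := FW _ Ww.
  have [n nn0 /(Lmono _ _ nn0) Lf] := Hn0 _ fF.
  rewrite -[w](mulgVK f); apply: (sgM sL) => //.
  apply: (Lmono _ _ (leq0n n0)); apply: V'L; split=> //.
  apply: (sgM sB); first exact/LooB/WLL.
  by apply: (sgV sB); exact/LooB/FL.
have subC : submodule gs C by [].
have [W1 [cW1 W1C CW1]] := IH _ _ (subP n0.+1) (submodule_setI subC (subP n0.+1))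
  (clP _) (closedI clC (clP _)) (@subIsetr _ _ _) (comp_gen_poly_le g subB0 n0.+1 gB0).
exists W1; split=> //; first by move=> x /W1C[].
set X := stable_gen _ _.
have sX : is_subgroup X by exact: subgroup_stable_gen.
have tX : conj_stable (g :: gs) X by exact: conj_stable_gen.
have C1X : C `&` poly_le B0 g n0.+1 `<=` X.
  by apply: subset_trans CW1 _; exact: stable_gen_cons.
(* Division with remainder: the leading coefficient [a] of [c] is in [L n0], so it is that of some
   [c0] in [C] of degree at most [n0.+1]. Removing [c0 ^ (g ^+ (n - n0))] from [c] lowers the
   degree. *)
have CX n : C `&` poly_le B0 g n `<=` X.
  elim: n => [|n IHn] c [Cc Pc].
    by apply: C1X; split=> //; exact: (poly_le_mono subB0 (leq0n _)) Pc.
  have [nn0|n0n] := leqP n n0.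
    by apply: C1X; split=> //; apply: (poly_le_mono subB0 _) Pc.
  have [sP _ _ _] := subP n; have [sP0 _ _ _] := subP n0.
  have [sP1 _ _ _] := subP n0.+1.
  case: Pc => x Px [y /= B0y Exy].
  set a := y ^ (g ^- n.+1) in B0y.
  have ya : a ^ (g ^+ n.+1) = y by rewrite conjgKV.
  have [_ [y0 Py0 [c0 Cc0 E0]]] : L n0 a.
    apply: Ln0; exists n => //; split=> //=; rewrite ya.
    exists x^-1; first exact: sgV.
    by exists c => //; rewrite -Exy mulKg.
  have Xc0 : X c0.
    apply: C1X; split=> //; apply: (sgMl sP1 (poly_leS subB0 Py0)).
    by rewrite E0; exact: (monomial_poly_le _ subB0).
  have yE : y = y0 ^ (g ^+ (n - n0)) * c0 ^ (g ^+ (n - n0)).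
    rewrite -conjMg E0 -conjgM -expgnDr -ya; congr (_ ^ (_ ^+ _)).
    by rewrite addSn subnKC // ltnW.
  have Cc0' : C (c0 ^ (g ^+ (n - n0))) by exact: conj_stableX tC _.
  have Xc0' : X (c0 ^ (g ^+ (n - n0))) by exact: conj_stableX tX _.
  have cE : c = x * y0 ^ (g ^+ (n - n0)) * c0 ^ (g ^+ (n - n0)).
    by rewrite -Exy yE mulgA.
  rewrite cE; apply: (sgM sX) => //; apply: IHn; split.
    by apply: (sgMr sC Cc0'); rewrite -cE.
  apply: (sgM sP) => //.
  have := poly_le_conjX subB0 (n - n0) Py0.
  by rewrite subnKC // ltnW.
(* [c] need not be a polynomial, but [c ^ (g ^+ k)] is; stability of [X] under [g^-1] brings [c]
   back. *)
move=> c Cc; have [n [k Pc]] := exhaust_poly_le subB0 WB0 BW (CB _ Cc).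
have Xc : X (c ^ (g ^+ k)).
  by apply: (CX n); split=> //; exact: conj_stableX tC _.
elim: k Xc {Pc} => [|k IHk]; first by rewrite conjg1.
rewrite expgSr conjgM => Xc; apply: IHk.
rewrite -[c ^ (g ^+ k)](conjgK g).
by apply: (tX _ _ _ Xc).2; exact: mem_head.
Qed.

End ClosedSubmodules.

(** * Closed normal subgroups of metabelian groups *)

Section Metabelian.
Variable G : topGroupType.
Implicit Types (x y z g : G) (A B C D H K M N S U V W X : set G) (gs : seq G).

Lemma commMg x y z : [~ x * y, z] = [~ x, z] ^ y * [~ y, z].
Proof. by rewrite !commgEl !conjgE !invgM !mulgA !mulgK. Qed.

Lemma commgM x y z : [~ x, y * z] = [~ x, z] * [~ x, y] ^ z.
Proof. by rewrite !commgEl !conjgE !invgM !mulgA !mulgK. Qed.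

Lemma commVg x y : [~ x^-1, y] = [~ y, x] ^ x^-1.
Proof. by rewrite !commgEl !conjgE !invgK !mulgA !mulgK. Qed.

Lemma stable_gen_nil gs X : stable_gen [::] X `<=` stable_gen gs X.
Proof.
apply: stable_gen_min => //; first exact: subgroup_stable_gen.
exact: sub_stable_gen.
Qed.

Lemma abelian_mod_closure D H : closed H -> abelian_mod D H ->
  abelian_mod (closure D) H.
Proof.
move=> clH aDH x y clx cly.
have cont_l z : continuous (fun t : G => [~ t, z]).
  apply: continuous_mulg; first exact: invg_continuous.
  by apply: continuous_conjg; [exact: continuous_idfun|exact: cst_continuous].
have cont_r z : continuous (fun t : G => [~ z, t]).
  apply: continuous_mulg; first exact: cst_continuous.
  by apply: continuous_conjg; [exact: cst_continuous|exact: continuous_idfun].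
apply: (closure_map (cont_l y) clH) clx => {}x Dx.
by apply: (closure_map (cont_r x) clH) cly => {}y Dy; exact: aDH.
Qed.

Lemma generated_ind K M : generated_subgroup K = [set: G] ->
  is_subgroup M -> K `<=` M -> forall x, M x.
Proof.
move=> genK sM KM x; have : generated_subgroup K x by rewrite genK.
exact.
Qed.

(** With [S] the union of [V], [K] and [K^-1], a finite [F] has [S S] inside [V F]; left
    multiplication by [S] then preserves [S <F>]. *)
Lemma cocompact_fin_gen K V : compact K -> generated_subgroup K = [set: G] ->
  compact V -> nbhs (1 : G) V ->
  exists S gs, compact S /\ forall x, mulset S (stable_gen [::] [set` gs]) x.
Proof.
move=> cK genK cV V1; pose S := V `|` (K `|` [set x^-1 | x in K]).
have cS : compact S.
  by apply: compactU => //; apply: compactU => //; exact: compact_inv.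
have [F [_ FS]] := compact_translates (compact_mulset cS cS)
  (@subset_closure _ (mulset S S)) V1.
exists S, F; split=> //; set M := stable_gen _ _.
have sM : is_subgroup M by exact: subgroup_stable_gen.
have step s y : S s -> mulset S M y -> mulset S M (s * y).
  move=> Ss [t St [m Mm <-]].
  have [|f fF Vf] := FS (s * t); first by exists s => //; exists t.
  exists (s * t * f^-1); first by left.
  exists (f * m); last by rewrite !mulgA mulgVK.
  by apply: (sgM sM) => //; apply: sub_stable_gen.
have S1 : mulset S M 1.
  exists 1; first by left; exact: nbhs_singleton.
  by exists 1; [exact: sg1|rewrite mulg1].
suff all x : forall y, mulset S M y -> mulset S M (x * y) /\ mulset S M (x^-1 * y).
  by move=> x; rewrite -[x]mulg1; exact: (all x 1 S1).1.
move: x; apply: (generated_ind genK).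
- split.
  + by move=> y; rewrite invg1 mul1g.
  + move=> u v Pu Pv y Sy; rewrite invgM -!mulgA; split.
      by apply: (Pu _ _).1; apply: (Pv _ _).1.
    by apply: (Pv _ _).2; apply: (Pu _ _).2.
  + by move=> u Pu y Sy; rewrite invgK; have [] := Pu _ Sy.
- move=> k Kk y Sy; split; apply: step => //; right; first by left.
  by right; exists k.
Qed.

Lemma conj_stable_group gs M x g : conj_stable gs M ->
  stable_gen [::] [set` gs] g -> M x -> M (x ^ g).
Proof.
move=> tM gg; suff : forall y, M y -> M (y ^ g) /\ M (y ^ g^-1).
  by move=> tg /tg[].
move: g gg; apply: stable_gen_min => //.
- split.
  + by move=> y My; rewrite invg1 conjg1.
  + move=> g h tg th y My; rewrite invgM !conjgM; split.
      by apply: (th _ _).1; apply: (tg _ _).1.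
    by apply: (tg _ _).2; apply: (th _ _).2.
  + by move=> g tg y My; rewrite invgK; have [] := tg _ My.
- by move=> g ggs y; exact: tM.
Qed.

(** For fixed [t], the [x] with [[~ x, t]] in [M] form a subgroup since [M] is normal; this is
    applied in each variable. *)
Lemma commutators_of_generators K M : generated_subgroup K = [set: G] ->
  is_normal_subgroup M -> (forall s t, K s -> K t -> M [~ s, t]) ->
  forall x y, M [~ x, y].
Proof.
move=> genK [sM nM] KM.
have half t : (forall s, K s -> M [~ s, t]) -> forall x, M [~ x, t].
  move=> Kt; apply: (generated_ind genK) => //; split; first by rewrite comm1g; exact: sg1.
    by move=> u v Mu Mv; rewrite commMg; apply: sgM => //; exact: nM.
  by move=> u Mu; rewrite commVg -invgR; apply: nM; exact: sgV.
move=> x y; apply: (half) => s Ks; rewrite -invgR; apply: sgV => //.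
by apply: half => t Kt; exact: KM.
Qed.

Lemma derived_commutator x y : @derived_subgroup G [~ x, y].
Proof. by move=> M _; apply; exists x => //; exists y. Qed.

Lemma subgroup_derived : is_subgroup (@derived_subgroup G).
Proof.
split; first by move=> M sM _; exact: sg1.
  by move=> x y dx dy M sM cM; apply: sgM => //; [exact: dx|exact: dy].
by move=> x dx M sM cM; apply: sgV => //; exact: dx.
Qed.

Lemma compact_symmetric_nbhs : locally_compact_group G ->
  exists V, [/\ compact V, nbhs (1 : G) V & forall x, V x -> V x^-1].
Proof.
move=> [_ /(_ 1)[V [V1 cV]]]; exists (V `|` [set x^-1 | x in V]); split.
- by apply: compactU => //; exact: compact_inv.
- by apply: filterS V1 => x; left.
- by move=> x [Vx|[y Vy <-]]; [right; exists x|left; rewrite invgK].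
Qed.

(** Commutators of [K] generate [[G, G]] as a normal subgroup; as [G = S <gs>], their [S]-conjugates
    suffice under [gs]. Adjoining [V :&: A] makes the generated subgroup open in [A], hence
    closed. *)
Lemma closure_derived_comp_gen S K V gs :
  compact K -> generated_subgroup K = [set: G] ->
  compact S -> (forall x, mulset S (stable_gen [::] [set` gs]) x) ->
  compact V -> nbhs (1 : G) V ->
  comp_gen gs [set 1] (closure (@derived_subgroup G)).
Proof.
move=> cK genK cS SG cV V1; set A := closure _.
have sA : is_subgroup A by apply: subgroup_closure; exact: subgroup_derived.
have clA : closed A by exact: closed_closure.
have cA x y : A [~ x, y] by apply: subset_closure; exact: derived_commutator.
have nA x g : A x -> A (x ^ g) by exact: normal_of_commutators.
pose T0 := [set [~ s, t] | s in K & t in K].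
pose T := [set t ^ s | t in T0 & s in S].
have cT0 : compact T0.
  apply: compact_image2 => //; apply: continuous_mulg.
    by apply: continuous_invg; exact: continuous_pair1.
  by apply: continuous_conjg; [exact: continuous_pair1|exact: continuous_pair2].
have cT : compact T.
  apply: compact_image2 => //.
  by apply: continuous_conjg; [exact: continuous_pair1|exact: continuous_pair2].
have TA : T `<=` A.
  by move=> _ [_ [s _ [t _ <-]] [u _ <-]]; exact: nA.
exists (T `|` (V `&` A)); split.
- by apply: compactU => //; exact: compact_closedI.
- by move=> x [/TA|[]].
set M := stable_gen _ _.
have sM : is_subgroup M by exact: subgroup_stable_gen.
have tM : conj_stable gs M by exact: conj_stable_gen.
have MA : M `<=` A.
  apply: stable_gen_min => // [g x _ Ax|x [[/TA//|[//]]|->]].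
    by split; exact: nA.
  exact: sg1.
apply: closure_min.
  apply: (subgroup_relopen_closed clA sM sA MA V1) => x VAx.
  by apply: sub_stable_gen; left; right.
suff cM x y : M [~ x, y] by move=> x; apply=> // _ [u _ [v _ <-]].
(* The normal core of [M], as [M] is so far only stable under [gs]. *)
pose M1 := [set x | forall g, M (x ^ g)].
suff /(_ 1) : M1 [~ x, y] by rewrite conjg1.
apply: (commutators_of_generators (M := M1) genK).
  split; last by move=> u g Mu h; rewrite -conjgM.
  split.
  - by move=> g; rewrite conj1g; exact: (sg1 sM).
  - by move=> u v Mu Mv g; rewrite conjMg; exact: (sgM sM).
  - by move=> u Mu g; rewrite conjVg; exact: (sgV sM).
move=> s t Ks Kt g; have [u Su [h Gh <-]] := SG g; rewrite conjgM.
apply: (conj_stable_group tM Gh); apply: sub_stable_gen; left; left.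
by exists [~ s, t]; [exists s => //; exists t|exists u].
Qed.

Lemma closed_normal_comp_gen N : locally_compact_group G ->
  compactly_generated G -> metabelian G -> is_closed_normal_subgroup N ->
  exists gs, comp_gen gs [set 1] N.
Proof.
move=> lcG [K [cK genK]] mG [[sN nN] clN].
have [V [cV V1 Vsym]] := compact_symmetric_nbhs lcG.
have [S [gs [cS SG]]] := cocompact_fin_gen cK genK cV V1.
have cl1 : closed [set (1 : G)].
  by apply: compact_closed; [case: lcG|exact: compact_set1].
have s1 := subgroup_set1 G.
pose A := closure (@derived_subgroup G).
have sA : is_subgroup A by apply: subgroup_closure; exact: subgroup_derived.
have clA : closed A by exact: closed_closure.
have cA x y : A [~ x, y] by apply: subset_closure; exact: derived_commutator.
have nA x g : A x -> A (x ^ g) by exact: normal_of_commutators.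
have gA : comp_gen gs [set 1] A by exact: (closure_derived_comp_gen cK genK cS SG cV V1).
have aA : abelian_mod A [set 1].
  apply: abelian_mod_closure => // x y dx dy.
  by rewrite /= commgEl conjgE (mG x y dx dy) mulKg mulVg.
have one_sub M : is_subgroup M -> [set 1] `<=` M by move=> sM _ ->; exact: sg1.
have tnormal M : (forall x g, M x -> M (x ^ g)) -> conj_stable gs M.
  by move=> nM g x _ Mx; split; exact: nM.
pose H := N `&` A.
have sH : is_subgroup H by exact: subgroup_setI.
have nH x g : H x -> H (x ^ g) by move=> [Nx Ax]; split; [exact: nN|exact: nA].
have clH : closed H by exact: closedI.
have [W1 [cW1 W1H HW1]] : comp_gen gs [set 1] H.
  apply: (closed_submodule_comp_gen sA s1 _ cA aA cV V1 Vsym) gA => //.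
  - by move=> x g ->; exact: conj1g.
  - by split=> //; [exact: tnormal|exact: one_sub].
  - by split=> //; [exact: tnormal|exact: one_sub|exact: subIsetr].
  - exact: subIsetr.
pose D := mulset N A.
have ND : N `<=` D.
  by move=> x Nx; exists x => //; exists 1; [exact: sg1|rewrite mulg1].
have AD : A `<=` D.
  by move=> x Ax; exists 1; [exact: sg1|exists x => //; rewrite mul1g].
have sD : is_subgroup D.
  split; first by apply: ND; exact: sg1.
    move=> _ _ [m Nm [a Aa <-]] [n Nn [b Ab <-]].
    exists (m * n); first exact: sgM.
    exists (a ^ n * b); first by apply: (sgM sA) => //; exact: nA.
    by rewrite conjgE !mulgA mulgK.
  move=> _ [n Nn [a Aa <-]]; exists n^-1; first exact: sgV.
  exists (a^-1 ^ n^-1); first by apply: nA; exact: (sgV sA).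
  by rewrite conjgE invgK invgM !mulgA mulVg mul1g.
have NC x y : N x -> N [~ x, y].
  by move=> Nx; rewrite commgEl; apply: sgM => //; [exact: sgV|exact: nN].
(* Commutators with [N] stay in [N] and those within [A] are trivial, so the commutators of [N A]
   lie in [N :&: A]. *)
have aDH : abelian_mod D H.
  move=> _ _ [m Nm [a Aa <-]] [n Nn [b Ab <-]]; split=> //.
  rewrite commMg (commgM a) (aA _ _ Aa Ab) mul1g.
  apply: sgM => //; first by apply: nN; exact: NC.
  by apply: nN; rewrite -invgR; apply: sgV => //; exact: NC.
pose A2 := closure D.
have sA2 : is_subgroup A2 by exact: subgroup_closure.
have clA2 : closed A2 by exact: closed_closure.
have DA2 : D `<=` A2 by exact: subset_closure.
have AA2 : A `<=` A2 by exact: subset_trans DA2.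
have cA2 x y : A2 [~ x, y] by exact: AA2.
have aA2 : abelian_mod A2 H by exact: abelian_mod_closure.
have nA2 x g : A2 x -> A2 (x ^ g) by exact: normal_of_commutators.
have gG : comp_gen [::] A [set: G].
  exists K; split=> // x _; move: x; apply: (generated_ind genK).
    exact: subgroup_stable_gen.
  by move=> k Kk; apply: sub_stable_gen; left.
have aG : abelian_mod [set: G] A by move=> x y _ _; exact: cA.
(* Generators of [A2] modulo [A] come from the abelian group [G / A]; those of [A] are added in
   [gA2]. *)
have [W2 [cW2 W2A2 A2W2]] : comp_gen [::] A A2.
  exact: (comp_gen_abelian cV V1 Vsym (@closedT _) clA2 sA (subgroup_setT G)
    sA2 AA2 (@subsetT _ _) aG gG).
have [W0 [cW0 W0A AW0]] := gA.
have gA2 : comp_gen gs H A2.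
  exists (W2 `|` W0); split; first exact: compactU.
    by move=> x [/W2A2|/W0A/AA2].
  move=> x /A2W2 /(@stable_gen_nil gs); move: x; apply: stable_genS.
  move=> x [W2x|/AW0]; first by apply: sub_stable_gen; left; left.
  move: x; apply: stable_genS => x [W0x|->].
    by apply: sub_stable_gen; left; right.
  exact: (sg1 (subgroup_stable_gen _ _)).
have [W3 [cW3 W3N NW3]] : comp_gen gs H N.
  apply: (closed_submodule_comp_gen sA2 sH nH cA2 aA2 cV V1 Vsym) gA2 => //.
  - split=> //; first exact: tnormal.
    by apply: subset_trans AA2; exact: subIsetr.
  - split=> //; first exact: tnormal; first exact: subIsetl.
    exact: subset_trans DA2.
  - exact: subset_trans DA2.
exists gs, (W3 `|` W1); split; first exact: compactU.
  by move=> x [/W3N|/W1H[]].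
move=> x /NW3; move: x; apply: stable_genS => x [W3x|/HW1].
  by apply: sub_stable_gen; left; left.
move: x; apply: stable_genS => x [W1x|->].
  by apply: sub_stable_gen; left; right.
exact: (sg1 (subgroup_stable_gen _ _)).
Qed.

End Metabelian.

(** * Cocompactness along the ascending sequence *)

Theorem mainTheorem15 (G : topGroupType) (Nseq : nat -> set G) :
  locally_compact_group G ->
  compactly_generated G ->
  metabelian G ->
  (forall n, is_closed_normal_subgroup (Nseq n)) ->
  (forall n, Nseq n `<=` Nseq n.+1) ->
  exists n0 : nat, forall n, (n0 <= n)%N ->
    cocompact_in (Nseq n) (closure (\bigcup_k Nseq k)).
Proof.
move=> lcG cgG mG nN NS.
have Nmono m n : (m <= n)%N -> Nseq m `<=` Nseq n.
  move=> /subnK <-; elim: (n - m)%N => [//|k IH].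
  by apply: subset_trans IH _; exact: NS.
set D := \bigcup_k Nseq k; set N := closure D.
have sNn n : is_subgroup (Nseq n) by case: (nN n) => -[].
have nNn n x g : Nseq n x -> Nseq n (x ^ g) by case: (nN n) => -[_ +] _; exact.
have sD : is_subgroup D.
  split; first by exists 0%N => //; exact: sg1.
    move=> x y [m _ Nx] [n _ Ny]; exists (maxn m n) => //.
    by apply: (sgM (sNn _)); [apply: Nmono Nx; exact: leq_maxl|
      apply: Nmono Ny; exact: leq_maxr].
  by move=> x [m _ Nx]; exists m => //; exact: (sgV (sNn _)).
have sN : is_subgroup N by exact: subgroup_closure.
have normN x g : N x -> N (x ^ g).
  by apply: closure_stable => y [m _ Ny]; exists m => //; exact: nNn.
have clN : closed N by exact: closed_closure.
have DN : D `<=` N by exact: subset_closure.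
have NnN n : Nseq n `<=` N by move=> x Nx; apply: DN; exists n.
have [V [cV V1 Vsym]] := compact_symmetric_nbhs lcG.
have [//|gs [W [cW WN NW]]] := closed_normal_comp_gen lcG cgG mG (N := N).
have tN : conj_stable gs N by move=> g x _ Nx; split; exact: normN.
have [F [FD FM]] := dense_generators clN sN tN cV V1 Vsym cW WN NW DN
  (@subset_refl _ _).
have [f /FD[n _ Nf]|n0 Hn0] := @uniform_bound _ F (fun f n => Nseq n f).
  by exists n.
(* The compact set [V :&: N] serves all [n >= n0] at once: [n0] only has to put the finite set [F]
   inside [Nseq n0]. *)
exists n0 => n n0n; exists (V `&` N); split; first exact: compact_closedI.
apply/seteqP; split; last first.
  by move=> _ [v [_ Nv] [m /NnN Nm <-]]; exact: (sgM sN).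
apply: FM => //.
- by move=> g x _ Nx; split; exact: nNn.
- by move=> m x Nm _; exact: nNn.
- by move=> f /Hn0[m mn0 Nf]; apply: Nmono Nf; exact: leq_trans n0n.
- by move=> _ ->; exact: sg1.
Qed.
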